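(* For all integers $m\ge 0$ and $n\ge 2$, $$r_{m,n}(q)=\frac{1}{(q^n-1)\,q^{m+n+1}\,r_{m+2,n-2}(q)}\det\begin{pmatrix} r_{m,n-1}(q) & r_{m+1,n-1}(q)\\ r_{m+1,n-1}(q) & r_{m+2,n-1}(q)\end{pmatrix}.$$
   Context: Let $q$ be an indeterminate. Set $a(n,q)=q^{\binom n2}$ for integers $n\ge 0$ and $a(n,q)=0$ for integers $n<0$. For integers $m\ge 0$ and $n\ge 1$ define the Hankel determinant $$D_{-m,n}(q)=\det\bigl(a(-m+i+j,q)\bigr)_{i,j=0}^{n-1},$$ and set $D_{-m,0}(q)=1$. The determinant $D_{0,n+1}(q)$ is a nonzero polynomial for every $n\ge 0$, so for integers $m,n\ge 0$ a rational function $r_{m,n}(q)$ is uniquely determined by $$D_{-m,n+m+1}(q)=(-1)^{\binom{m+1}{2}}\,r_{m,n}(q)\,q^{m\binom n2}\,D_{0,n+1}(q).$$ The identity is in the field of rational functions in $q$. *)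

(* Defs.v *)
From HB Require Import structures.
From mathcomp Require Import all_boot all_order all_algebra.

Set Implicit Arguments.
Unset Strict Implicit.
Unset Printing Implicit Defensive.

Import GRing.Theory.
Local Open Scope ring_scope.

(* The field F(q) of rational functions in one indeterminate over F. *)
Definition ratfun (F : fieldType) : fieldType := {fraction {poly F}}.

Definition qvar (F : fieldType) : ratfun F := tofrac 'X.

Definition a (K : fieldType) (k : int) (q : K) : K :=
  match k with
  | Posz n => q ^+ 'C(n, 2)
  | Negz _ => 0
  end.

(* [D m n q] is D_{-m,n}(q): the first index is the opposite of the shift.
   For n = 0 it is the empty determinant, which is 1. *)
Definition D (K : fieldType) (m n : nat) (q : K) : K :=
  \det (\matrix_(i < n, j < n) a (- m%:Z + i%:Z + j%:Z) q).

(* Main.v *)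
(** Taking ratios turns the claim into the Desnanot-Jacobi (Dodgson) identity for
the Hankel matrix of D_{-(m+2),m+n+2}, whose corner minors are again Hankel
determinants, together with the ratio D_{0,n+1} D_{0,n-1} / D_{0,n}^2, read off the
Vandermonde evaluation of D_{0,n}.

To see that r_{m,n} is not zero, over any field, expand D_{-m,N} (N > m) over
permutations: exactly one of them, i |-> m - i for i <= m and i |-> i for i > m,
contributes a term of maximal degree in q.  Its optimality and uniqueness are
certified by a dual solution of the assignment problem. *)

Require Import Defs.
From mathcomp Require Import all_boot all_order all_algebra.
From mathcomp Require Import all_fingroup zify ring.

Import Order.TTheory GRing.Theory Num.Theory.
Local Open Scope ring_scope.

(** * Polynomial determinants with a single term of maximal degree *)

(* [u] and [v] are dual potentials showing that [s0] is the only permutation of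
   maximal weight. *)
Lemma det_monomial_neq0 (R : comNzRingType) (N : nat)
    (b : 'I_N -> 'I_N -> bool) (w : 'I_N -> 'I_N -> nat)
    (c : int) (u v : 'I_N -> int) (s0 : 'S_N) :
  0 < c -> (forall i, b i (s0 i)) ->
  (forall i j, b i j -> c * (w i j)%:Z <= u i + v j ?= iff (j == s0 i)) ->
  \det (\matrix_(i, j) if b i j then 'X^(w i j) else 0 : {poly R}) != 0.
Proof.
move=> c_gt0 bs0 le_w; set A := \matrix_(_, _) _.
have prodA (s : 'S_N) : (forall i, b i (s i)) ->
    \prod_i A i (s i) = 'X^(\sum_i w i (s i)).
  by move=> bs; rewrite expr_sum; apply: eq_bigr => i _; rewrite mxE bs.
have coef_term (s : 'S_N) : ((-1) ^+ s * \prod_i A i (s i))`_(\sum_i w i (s0 i))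
    = (-1) ^+ s * (s == s0)%:R.
  rewrite !mulr_sign (fun_if (fun p : {poly R} => p`__)) coefN.
  suff -> : (\prod_i A i (s i))`_(\sum_i w i (s0 i)) = (s == s0)%:R by [].
  have [bs|/forallPn[i nbi]] := boolP [forall i, b i (s i)]; last first.
    rewrite (bigD1 i) //= mxE (negPf nbi) mul0r coef0.
    by case: eqP nbi => // ->; rewrite bs0.
  move/forallP in bs; rewrite prodA // coefXn.
  (* The total potential is the same for every permutation, so the entrywise bounds add up to one
     bound on all weights, attained only at [s0]. *)
  have sum_uv (t : 'S_N) : \sum_i (u i + v (t i)) = \sum_i u i + \sum_i v i.
    by rewrite big_split /= [\sum_i v i](reindex_inj (@perm_inj _ t)).
  have le_sum (t : 'S_N) : (forall i, b i (t i)) ->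
      c * (\sum_i w i (t i))%N%:Z <= \sum_i u i + \sum_i v i
        ?= iff [forall i, t i == s0 i].
    move=> bt; rewrite -(sum_uv t) -natz natr_sum mulr_sumr.
    by apply: leif_sum => i _; rewrite natz; apply: le_w.
  have [_ Es] := le_sum s bs; have [_ E0] := le_sum s0 bs0.
  have -> : (s == s0) = [forall i, s i == s0 i].
    apply/eqP/forallP => [-> //|e]; apply/permP => i; exact/eqP.
  rewrite -Es; have /eqP <- : c * (\sum_i w i (s0 i))%N%:Z == \sum_i u i + \sum_i v i.
    by rewrite E0; apply/forallP.
  by rewrite (inj_eq (mulfI (lt0r_neq0 c_gt0))) eqz_nat eq_sym.
apply/eqP => /(congr1 (fun p : {poly R} => p`_(\sum_i w i (s0 i)))).
rewrite coef0 coef_sum (bigD1 s0) //= coef_term eqxx mulr1 big1 ?addr0.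
  by move/eqP; rewrite signr_eq0.
by move=> s /negPf ns; rewrite coef_term ns mulr0.
Qed.

(* The potential is a function of X = 2k - m: it is odd, linear of slope m, where it
   has to pair off X and -X, and elsewhere it is the value X (X - 1) forced by the
   diagonal entries. *)
Lemma leif_binomial_potential (m i j : nat) : (m <= i + j)%N ->
  let U (k : nat) : int := if (k <= m)%N then m%:Z * (k.*2%:Z - m%:Z)
                 else (k.*2%:Z - m%:Z) * (k.*2%:Z - m%:Z - 1) in
  4%:Z * ('C(i + j - m, 2))%:Z <= U i + U j
    ?= iff (j == if (i <= m)%N then (m - i)%N else i).
Proof.
move=> h U.
have e : 2 * ('C(i + j - m, 2))%:Z = (i%:Z + j%:Z - m%:Z) * (i%:Z + j%:Z - m%:Z - 1).
  have [k ek] : exists k, k = (i + j - m)%N by exists (i + j - m)%N.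
  rewrite -ek; have -> : i%:Z + j%:Z - m%:Z = k by lia.
  elim: k {ek} => // k; rewrite binS bin1; nia.
have -> : 4%:Z * ('C(i + j - m, 2))%:Z
    = 2 * ((i%:Z + j%:Z - m%:Z) * (i%:Z + j%:Z - m%:Z - 1)) by rewrite -e mulrA.
move: e => _; apply/leifP; rewrite /U {U} -!mul2n !PoszM.
have {}h : m%:Z <= i%:Z + j%:Z by lia.
have i0 : 0 <= i%:Z by [].
have j0 : 0 <= j%:Z by [].
case: (leqP i m) => him; case: (leqP j m) => hjm.
(* With x = i + j - m, the gap [U i + U j] - 2x(x - 1) is 2x(m + 1 - x) here, which for 0 <= x <= m
   vanishes only at x = 0. In the two mixed cases it is strictly positive, and for i, j > m it is
   2(i - j)^2. The factor 4 keeps the potentials integral when m is odd. *)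
- case: eqP => hij.
    by apply/eqP; rewrite (_ : j%:Z = m%:Z - i%:Z); [ring | lia].
  have : 0 < i%:Z + j%:Z - m%:Z by lia.
  have : i%:Z + j%:Z - m%:Z <= m%:Z by lia.
  nia.
- have -> : (j == m - i)%N = false by lia.
  have [t [t0 et]] : exists t : int, 0 <= t /\ j%:Z = m%:Z + 1 + t.
    by exists (j%:Z - m%:Z - 1); lia.
  rewrite et.
  have {}him : i%:Z <= m%:Z by lia.
  nia.
- have -> : (j == i)%N = false by lia.
  have [t [t0 et]] : exists t : int, 0 <= t /\ i%:Z = m%:Z + 1 + t.
    by exists (i%:Z - m%:Z - 1); lia.
  rewrite et.
  have {}hjm : j%:Z <= m%:Z by lia.
  nia.
- case: eqP => hij; first by apply/eqP; rewrite hij; ring.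
  have : 0 < (i%:Z - j%:Z)^+2 by rewrite exprn_even_gt0 //=; lia.
  by rewrite expr2; lia.
Qed.

(** * Product formula for D_{0,n} *)

Lemma bin2D (i j : nat) : 'C(i + j, 2) = ('C(i, 2) + 'C(j, 2) + i * j)%N.
Proof.
elim: j => [|j IH]; first by rewrite !addn0 muln0 addn0.
by rewrite addnS !binS !bin1 IH; lia.
Qed.

Lemma a_shift (K : fieldType) (m i j : nat) (q : K) :
  a (- m%:Z + i%:Z + j%:Z) q = if (m <= i + j)%N then q ^+ 'C(i + j - m, 2) else 0.
Proof.
case: leqP => h.
  by have -> : - m%:Z + i%:Z + j%:Z = (i + j - m)%N%:Z by lia.
by have -> : - m%:Z + i%:Z + j%:Z = Negz (m - (i + j)).-1 by lia.
Qed.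

(** By [bin2D] the (i, j) entry is q^C(i,2) q^(ij) q^C(j,2): a Vandermonde matrix at the nodes q^j,
    scaled on both sides by the same diagonal matrix. *)
Lemma D0_prod (K : fieldType) (n : nat) (q : K) :
  D 0 n q = \prod_(j < n) (q ^+ ('C(j, 2)).*2 * \prod_(i < j) (q ^+ j - q ^+ i)).
Proof.
pose d : 'rV[K]_n := \row_j q ^+ 'C(j, 2).
pose V := Vandermonde n (\row_(j < n) q ^+ j).
have -> : D 0 n q = \det (diag_mx d *m V *m diag_mx d).
  congr (\det _); apply/matrixP => i j.
  rewrite mul_mx_diag mul_diag_mx !mxE a_shift leq0n subn0 bin2D.
  by rewrite !exprD exprM exprAC; ring.
rewrite !det_mulmx det_diag det_Vandermonde (exchange_big_dep xpredT) //=.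
rewrite mulrAC -!big_split /=; apply: eq_bigr => j _.
rewrite !mxE -addnn exprD; congr (_ * _).
rewrite (big_ord_widen _ (fun i => q ^+ j - q ^+ i) (ltnW (ltn_ord j))).
by apply: eq_bigr => i _; rewrite !mxE.
Qed.

Lemma D0_step (K : fieldType) (n : nat) (q : K) :
  D 0 n.+2 q * D 0 n q = D 0 n.+1 q ^+ 2 * (q ^+ (3 * n) * (q ^+ n.+1 - 1)).
Proof.
pose f (j : nat) := \prod_(i < j) (q ^+ j - q ^+ i).
(* Split off the factor with i = 0 and take one q out of each of the n others. *)
have fS : f n.+1 = (q ^+ n.+1 - 1) * (q ^+ n * f n).
  rewrite /f big_ord_recl expr0; congr (_ * _).
  under eq_bigr do rewrite lift0 !exprS -mulrBr.
  by rewrite big_split /= prodr_const card_ord.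
rewrite !D0_prod 2!big_ord_recr /= -/(f n) -/(f n.+1) fS.
have -> : ('C(n.+1, 2)).*2 = (('C(n, 2)).*2 + n + n)%N by rewrite binS bin1; lia.
have -> : (3 * n = n + n + n)%N by lia.
by rewrite !exprD; ring.
Qed.

(** * The Desnanot-Jacobi identity *)

Lemma det_col_single (R : comPzRingType) (n : nat) (A : 'M[R]_n) (i j : 'I_n) :
  (forall k, k != i -> A k j = 0) -> \det A = A i j * cofactor A i j.
Proof.
move=> A0; rewrite (expand_det_col _ j) (bigD1 i) //= big1 ?addr0 // => k ki.
by rewrite A0 // mul0r.
Qed.

Lemma det_row_single (R : comPzRingType) (n : nat) (A : 'M[R]_n) (i j : 'I_n) :
  (forall k, k != j -> A i k = 0) -> \det A = A i j * cofactor A i j.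
Proof.
move=> A0; rewrite (expand_det_row _ i) (bigD1 j) //= big1 ?addr0 // => k kj.
by rewrite A0 // mul0r.
Qed.

(** Row 0 is zero off its two ends. The minor at its left end is triangular; in the one at its right
    end, the last row has the single entry [x ord_max], whose own minor is the identity. *)
Lemma det_replace_first_last (R : comPzRingType) (n : nat) (x y : 'I_n.+2 -> R) :
  \det (\matrix_(i, j) if j == ord0 then x i else if j == ord_max then y i
                       else (i == j)%:R)
  = x ord0 * y ord_max - x ord_max * y ord0.
Proof.
set B := \matrix_(_, _) _.
rewrite (expand_det_row _ ord0) big_ord_recl big_ord_recr /=.
rewrite big1 ?add0r; last first.
  move=> i _; rewrite mxE /= ; case: eqP => [/(congr1 val)/= |_].
    by rewrite /bump /=; have := ltn_ord i; lia.
  by rewrite mul0r.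
have lmax : lift ord0 ord_max = ord_max :> 'I_n.+2 by apply: val_inj.
rewrite lmax /cofactor !mxE /= expr0 mul1r.
pose B1 : 'M_n.+1 := row' ord0 (col' ord0 B).
pose B2 : 'M_n.+1 := row' ord0 (col' ord_max B).
rewrite -/B1 -/B2; have -> : \det B1 = y ord_max.
  rewrite -det_tr det_trig; last first.
    apply/is_trig_mxP => i j ij; rewrite !mxE /=.
    have -> : (lift ord0 i == ord_max) = false.
      by apply/eqP => /(congr1 val) /=; rewrite /bump /=; have := ltn_ord j; lia.
    by rewrite (inj_eq lift_inj) -val_eqE gtn_eqF.
  rewrite big_ord_recr big1 ?mul1r => [|i _]; rewrite !mxE /=.
    by rewrite lmax eqxx mul1r.
  rewrite eqxx; case: (lift ord0 _ =P ord_max) => [/(congr1 val)/= |_ //].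
  by rewrite /bump /=; have : (i < n)%N := ltn_ord i; lia.
rewrite (@det_row_single _ _ B2 ord_max ord0); last first.
  move=> j j0; rewrite !mxE.
  have -> : (lift ord_max j == ord0) = false.
    apply: contraNF j0 => /eqP/(congr1 val)/=; rewrite -val_eqE /= /bump.
    by have : (j < n.+1)%N := ltn_ord j; lia.
  rewrite eq_sym (negPf (neq_lift _ _)).
  by case: eqP => // /(congr1 val) /=; rewrite /bump; have : (j < n.+1)%N := ltn_ord j; lia.
rewrite /cofactor (_ : row' ord_max _ = 1%:M) ?det1.
  rewrite !mxE /= lmax.
  rewrite eqxx addn0 add0n exprS; congr (_ + _).
  have sq : (-1) ^+ n * (-1) ^+ n = 1 :> R by rewrite -expr2 sqrr_sign.
  transitivity (- (x ord_max * y ord0 * ((-1) ^+ n * (-1) ^+ n))); first by ring.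
  by rewrite sq mulr1.
apply/matrixP => i j; rewrite !mxE.
rewrite (_ : lift ord_max (lift ord0 j) = lift ord0 (lift ord_max j)).
  rewrite -[_ == ord0]negbK eq_sym neq_lift /=.
  rewrite -[_ == ord_max]negbK.
  have -> : (lift ord0 (lift ord_max j) != ord_max).
    by apply/eqP => /(congr1 val) /=; rewrite /bump; have : (j < n)%N := ltn_ord j; lia.
  by rewrite !(inj_eq lift_inj).
by apply: val_inj; rewrite /= /bump; have : (j < n)%N := ltn_ord j; lia.
Qed.

Lemma desnanot_jacobi (R : idomainType) (n : nat) (A : 'M[R]_n.+2) :
  \det A != 0 ->
  \det A * \det (row' ord_max (col' ord_max (row' ord0 (col' ord0 A))))
  = \det (row' ord0 (col' ord0 A)) * \det (row' ord_max (col' ord_max A))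
    - \det (row' ord0 (col' ord_max A)) * \det (row' ord_max (col' ord0 A)).
Proof.
(* Multiply A by the identity matrix whose outer columns are those of \adj A. *)
move=> A_neq0; pose B := \matrix_(i, j)
  if j == ord0 then (\adj A) i ord0 else if j == ord_max then (\adj A) i ord_max
  else (i == j)%:R.
have AB i j : (A *m B) i j = if j == ord0 then \det A *+ (i == ord0)
    else if j == ord_max then \det A *+ (i == ord_max) else A i j.
  have adjE k : \sum_l A i l * (\adj A) l k = \det A *+ (i == k).
    by have /matrixP/(_ i k) := mul_mx_adj A; rewrite !mxE.
  rewrite mxE; under eq_bigr do rewrite [B _ _]mxE.
  case: eqP => [_|_]; first exact: adjE.
  case: eqP => [_|_]; first exact: adjE.
  rewrite (bigD1 j) //= eqxx mulr1 big1 ?addr0 // => k /negPf ->.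
  by rewrite mulr0.
(* The outer columns of [A *m B] are [\det A] times unit vectors; expanding along both leaves the
   central minor of [A]. *)
have detAB : \det (A *m B)
    = \det A ^+ 2 * \det (row' ord_max (col' ord_max (row' ord0 (col' ord0 A)))).
  rewrite (@det_col_single _ _ _ ord0 ord0) => [|k /negPf k0]; last first.
    by rewrite AB eqxx k0.
  rewrite AB !eqxx /cofactor addn0 expr0 mul1r expr2 -mulrA; congr (_ * _).
  have lmax : lift ord0 ord_max = ord_max :> 'I_n.+2 by apply: val_inj.
  rewrite (@det_col_single _ _ _ ord_max ord_max) => [|k /negPf kmax]; last first.
    by rewrite 2![in LHS]mxE AB lmax /= eqxx -lmax (inj_eq lift_inj) kmax.
  rewrite 2![in LHS]mxE AB lmax /= eqxx /cofactor addnn -signr_odd odd_double mul1r.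
  congr (_ * \det _); apply/matrixP => i j; rewrite 4![LHS]mxE 4![RHS]mxE AB.
  rewrite -[_ == ord0]negbK eq_sym neq_lift /=.
  by rewrite -lmax (inj_eq lift_inj) -[_ == ord_max]negbK eq_sym neq_lift.
apply: (mulfI A_neq0); rewrite mulrA -expr2 -detAB det_mulmx; congr (_ * _).
rewrite det_replace_first_last !mxE /cofactor.
have sgn k : (-1) ^+ (k + k) = 1 :> R by rewrite exprD -expr2 sqrr_sign.
rewrite !sgn !mul1r; congr (_ - _).
by rewrite mulrACA -exprD [(ord0 + ord_max)%N]addnC sgn mul1r.
Qed.

(** * Nonvanishing and condensation of the Hankel determinants *)

Lemma D_neq0 (F : fieldType) (m n : nat) : (m < n)%N -> D m n (qvar F) != 0.
Proof.
case: n => // n lt_mn.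
(* Since m - i <= m < n + 1, [inord] never takes its default value. *)
pose flip (i : 'I_n.+1) : 'I_n.+1 := if (i <= m)%N then inord (m - i) else i.
have flipE i : flip i = (if (i <= m)%N then m - i else i)%N :> nat.
  by rewrite /flip; case: leqP => // h; rewrite inordK //; lia.
have flipK : involutive flip.
  by move=> i; apply: val_inj; rewrite /= !flipE; case: (leqP i m) => h; case: leqP; lia.
pose P := \matrix_(i < n.+1, j < n.+1)
  if (m <= i + j)%N then 'X^('C(i + j - m, 2)) else 0 : {poly F}.
have -> : D m n.+1 (qvar F) = tofrac (\det P).
  rewrite -det_map_mx; congr (\det _); apply/matrixP => i j.
  by rewrite !mxE a_shift; case: ifP => _; rewrite ?rmorph0 // rmorphXn.
rewrite tofrac_eq0.
pose U (k : nat) : int := if (k <= m)%N then m%:Z * (k.*2%:Z - m%:Z)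
  else (k.*2%:Z - m%:Z) * (k.*2%:Z - m%:Z - 1).
apply: (@det_monomial_neq0 _ _ (fun i j => m <= i + j)%N _ 4%:Z
  (fun i => U i) (fun i => U i) (perm (inv_inj flipK))) => // [i|i j h].
  by rewrite permE flipE; case: (leqP i m); lia.
by rewrite permE -val_eqE /= flipE; apply: leif_binomial_potential.
Qed.

Lemma D_desnanot (K : fieldType) (m n : nat) (q : K) : D m.+2 n.+2 q != 0 ->
  D m.+2 n.+2 q * D m n q = D m n.+1 q * D m.+2 n.+1 q - D m.+1 n.+1 q ^+ 2.
Proof.
move=> /desnanot_jacobi; rewrite -/(D _ _ _); set A := \matrix_(_, _) _.
(* A minor whose row and column selections raise i + j by the constant l is again Hankel, with shift
   m + 2 - l. *)
have e (p k l : nat) (f g : 'I_k -> 'I_n.+2) (B : 'M_k) :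
  (forall i j, B i j = A (f i) (g j)) -> (forall i j, (f i + g j = i + j + l)%N) ->
   (p + l)%N = m.+2 -> \det B = D p k q.
  move=> BE fg pl; congr (\det _); apply/matrixP => i j; rewrite BE !mxE.
  by congr (a _ q); have := fg i j; lia.
have lift_max_val (i : 'I_n.+1) : lift ord_max i = i :> nat.
  by rewrite /= /bump leqNgt ltn_ord.
rewrite (e m n 2%N (fun i => lift ord0 (lift ord_max i))
  (fun i => lift ord0 (lift ord_max i))); first last.
- by rewrite addn2.
- by move=> i j; rewrite /= /bump; have := ltn_ord i; have := ltn_ord j; lia.
- by move=> i j; rewrite 4!mxE.
rewrite (e m n.+1 2%N (lift ord0) (lift ord0)); first last.
- by rewrite addn2.
- by move=> i j; rewrite !lift0; lia.
- by move=> i j; rewrite 2!mxE.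
rewrite (e m.+2 n.+1 0%N (lift ord_max) (lift ord_max)); first last.
- by rewrite addn0.
- by move=> i j; rewrite !lift_max_val addn0.
- by move=> i j; rewrite 2!mxE.
rewrite (e m.+1 n.+1 1%N (lift ord0) (lift ord_max)); first last.
- by rewrite addn1.
- by move=> i j; rewrite lift0 lift_max_val; lia.
- by move=> i j; rewrite 2!mxE.
rewrite (e m.+1 n.+1 1%N (lift ord_max) (lift ord0)) //; first last.
- by rewrite addn1.
- by move=> i j; rewrite lift0 lift_max_val; lia.
by move=> i j; rewrite 2!mxE.
Qed.

(** * The recurrence for r *)

(** Division by 0 returns 0 here, so the nonvanishing of [r m.+2 n] is proved along with the
    formula, making the quotient a genuine one. *)
Lemma hankel_quotient_rec (K : fieldType) (q : K) (r : nat -> nat -> K) :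
  (forall m n, (m < n)%N -> D m n q != 0) ->
  (forall m n, D m (n + m + 1) q
     = (-1) ^+ 'C(m + 1, 2) * r m n * q ^+ (m * 'C(n, 2)) * D 0 (n + 1) q) ->
  forall m n, r m.+2 n != 0 /\
    r m n.+2 = 1 / ((q ^+ n.+2 - 1) * q ^+ (m + n.+2 + 1) * r m.+2 n)
               * (r m n.+1 * r m.+2 n.+1 - r m.+1 n.+1 ^+ 2).
Proof.
move=> D_neq0 hr m k.
have hr1 p l N : (l + p).+1 = N ->
    D p N q = (-1) ^+ 'C(p.+1, 2) * r p l * q ^+ (p * 'C(l, 2)) * D 0 l.+1 q.
  by move=> <-; rewrite -(addn1 (l + p)) hr !addn1.
have step : D 0 k.+3 q * D 0 k.+1 q
    = D 0 k.+2 q ^+ 2 * (q ^+ (3 * k.+1) * (q ^+ k.+2 - 1)) by exact: D0_step.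
have step_neq0 : D 0 k.+3 q * D 0 k.+1 q != 0 by rewrite mulf_neq0 ?D_neq0.
(* Both q and q^(k+2) - 1 are factors in [step], whose left side is nonzero; the exponent 3(k + 1)
   is positive. *)
have q_neq0 : q != 0.
  apply: contraNneq step_neq0 => q0.
  by rewrite step [X in X ^+ (3 * _)]q0 expr0n mul0r mulr0.
have qk_neq0 : q ^+ k.+2 - 1 != 0.
  by apply: contraNneq step_neq0 => qk0; rewrite step qk0 !mulr0.
have r_neq0 : r m.+2 k != 0.
  have : D m.+2 (k + m.+2).+1 q != 0 by apply: D_neq0; lia.
  by rewrite (hr1 _ k) //; apply: contraNneq => ->; rewrite mulr0 !mul0r.
split=> //.
have sgnE : (-1) ^+ 'C(m.+3, 2) = - (-1) ^+ 'C(m.+1, 2) :> K.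
  have -> : 'C(m.+3, 2) = ('C(m.+1, 2) + 2 * m.+1).+1.
    by rewrite (binS m.+2) (binS m.+1) !bin1; lia.
  by rewrite exprS exprD exprM sqrrN expr1n expr1n mulr1 mulN1r.
have sgnK p : (-1) ^+ p * (-1) ^+ p = 1 :> K by rewrite -expr2 sqrr_sign.
pose e p := q ^+ 'C(p, 2).
have ek : e k.+1 = e k * q ^+ k by rewrite /e binS bin1 addnC exprD mulrC.
have ek' : e k.+2 = e k * q ^+ k * q ^+ k * q.
  by rewrite {1}/e binS bin1 exprD -/(e k.+1) ek exprS; ring.
have eE p l : q ^+ (p * 'C(l, 2)) = e l ^+ p by rewrite mulnC exprM.
have lt_N : (m.+2 < (k.+1 + m).+3)%N by lia.
have := D_desnanot K m _ q (D_neq0 _ _ lt_N).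
rewrite (hr1 m.+2 k.+1); last by lia.
rewrite (hr1 m k.+1); last by lia.
rewrite (hr1 m k.+2); last by lia.
rewrite (hr1 m.+2 k); last by lia.
rewrite (hr1 m.+1 k.+1); last by lia.
rewrite !eE ek ek' sgnE.
set s := (-1) ^+ 'C(m.+1, 2); set s1 := (-1) ^+ 'C(m.+2, 2) => rec.
have ss : s * s = 1 := sgnK _; have ss1 : s1 * s1 = 1 := sgnK _.
(* As [e k * q ^+ k] is [e k.+1], this is the power of q and of D_{0,k+2} common to the products in
   [rec]. The products pairing m with m + 2 carry the sign -1 by [sgnE], the square carries +1. *)
pose T := (e k * q ^+ k) ^+ m ^+ 2 * (e k * q ^+ k * D 0 k.+2 q) ^+ 2.
have T_neq0 : T != 0.
  by rewrite !(mulf_neq0, expf_neq0) // D_neq0.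
have q3 : q ^+ (3 * k.+1) = (q ^+ k) ^+ 3 * q ^+ 3.
  by rewrite mulnC exprM [q ^+ k.+1]exprSr exprMn.
have qmn : q ^+ (m + k.+2 + 1) = q ^+ m * q ^+ k * q ^+ 3.
  by rewrite -!exprD; congr (_ ^+ _); lia.
have key : r m k.+2 * ((q ^+ k.+2 - 1) * q ^+ (m + k.+2 + 1) * r m.+2 k)
    = r m k.+1 * r m.+2 k.+1 - r m.+1 k.+1 ^+ 2.
  apply: (mulfI T_neq0).
  move: rec => /eqP; rewrite -subr_eq0 => /eqP rec.
  (* Subtracting [rec], in the form difference = 0, leaves a polynomial identity modulo [ss], [ss1]
     and [step]. *)
  rewrite -[LHS]subr0 -rec qmn {rec}.
  rewrite q3 in step.
  move: (q ^+ k.+2 - 1) step => z step.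
  rewrite /T !exprMn !exprS.
  ring: ss ss1 step.
by rewrite mulrC mulrA mulr1 -key mulfK // !mulf_neq0 ?expf_neq0.
Qed.

Lemma det_hankel2 (R : comPzRingType) (f : nat -> R) (m : nat) :
  \det (\matrix_(i < 2, j < 2) f (m + i + j)%N) = f m * f m.+2 - f m.+1 ^+ 2.
Proof.
rewrite (expand_det_row _ ord0) !big_ord_recl big_ord0 addr0.
rewrite /cofactor !det_mx11 !mxE /= /bump /= !addn0 !addn1.
by rewrite expr0 expr1 mul1r mulN1r mulrN -expr2.
Qed.

Theorem mainTheorem4 (F : fieldType) (r : nat -> nat -> ratfun F)
  (hr : forall m n : nat,
     D m (n + m + 1) (qvar F)
     = (-1) ^+ 'C(m + 1, 2) * r m n * qvar F ^+ (m * 'C(n, 2))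
       * D 0 (n + 1) (qvar F))
  (m n : nat) (hn : (2 <= n)%N) :
  r (m + 2)%N (n - 2)%N != 0 /\
  r m n
  = 1 / ((qvar F ^+ n - 1) * qvar F ^+ (m + n + 1) * r (m + 2)%N (n - 2)%N)
    * \det (\matrix_(i < 2, j < 2) r (m + i + j)%N (n - 1)%N).
Proof.
have [k ->] : exists k, n = k.+2 by exists (n - 2)%N; lia.
rewrite subn2 subn1 (addn2 m) /= (det_hankel2 _ (fun l => r l k.+1)).
exact: (hankel_quotient_rec _ _ _ (D_neq0 F) hr m k).
Qed.
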